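(* Let $\Lambda$ be a left hereditary ring. Then the stable category $\Lambda\text{-}\underline{\mathrm{Mod}}$ has kernels, and hence is finitely complete.
   Context: Rings are associative with identity; modules are left modules. The stable category $\Lambda\text{-}\underline{\mathrm{Mod}}$ has all left $\Lambda$-modules as objects; its morphisms are equivalence classes of $\Lambda$-homomorphisms, where $f$ and $g$ are equivalent if $f-g$ factors through a projective module. *)

(* Defs.v *)
From HB Require Import structures.
From mathcomp Require Import all_boot all_order all_algebra.
From mathcomp Require Import boolp.
(* for the choiceType instance on {linear U -> V} *)
From mathcomp Require Import prodnormedzmodule.

Set Implicit Arguments.
Unset Strict Implicit.
Unset Printing Implicit Defensive.

Import GRing.Theory.
Local Open Scope ring_scope.
Local Open Scope quotient_scope.

Record category := Category {
  obj :> Type;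
  hom : obj -> obj -> Type;
  idm : forall a, hom a a;
  comp : forall a b c, hom b c -> hom a b -> hom a c;
  comp_idl : forall a b (f : hom a b), comp (idm b) f = f;
  comp_idr : forall a b (f : hom a b), comp f (idm a) = f;
  compA : forall a b c d (h : hom c d) (g : hom b c) (f : hom a b),
    comp h (comp g f) = comp (comp h g) f }.

Arguments hom {_} a b.
Arguments idm {_} a.
Arguments comp {_ a b c} g f.

Record functor (J C : category) := Functor {
  fobj :> J -> C;
  fmap : forall a b, hom a b -> hom (fobj a) (fobj b);
  fmap_id : forall a, fmap (idm a) = idm (fobj a);
  fmap_comp : forall a b c (g : hom b c) (f : hom a b),
    fmap (comp g f) = comp (fmap g) (fmap f) }.

Record cone (J C : category) (F : functor J C) := Cone {
  apex : C;
  leg : forall j, hom apex (F j);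
  leg_natural : forall i j (f : hom i j), comp (fmap F f) (leg i) = leg j }.

Definition is_limit (J C : category) (F : functor J C) (L : cone F) : Prop :=
  forall K : cone F, exists! u : hom (apex K) (apex L),
    forall j, comp (leg L j) u = leg K j.

(* Neither finType nor finite_set applies here: the objects of the stable
   category of modules do not fit in the universe of an eqType. *)
Definition finite_type (T : Type) : Prop :=
  exists (n : nat) (e : 'I_n -> T), bijective e.

Definition finite_category (J : category) : Prop :=
  finite_type J /\ forall a b : J, finite_type (hom a b).

Definition finitely_complete (C : category) : Prop :=
  forall J : category, finite_category J ->
  forall F : functor J C, exists L : cone F, is_limit L.

Definition zero_object (C : category) (z : C) : Prop :=
  forall a : C, (exists! f : hom a z, True) /\ (exists! f : hom z a, True).

Definition zero_morphism (C : category) (a b : C) (f : hom a b) : Prop :=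
  exists z : C, zero_object z /\
  exists (g : hom z b) (h : hom a z), f = comp g h.

Definition is_kernel (C : category) (a b : C) (f : hom a b)
    (k : C) (i : hom k a) : Prop :=
  zero_morphism (comp f i) /\
  forall (x : C) (g : hom x a), zero_morphism (comp f g) ->
    exists! u : hom x k, comp i u = g.

Definition has_kernels (C : category) : Prop :=
  forall (a b : C) (f : hom a b), exists (k : C) (i : hom k a), is_kernel f i.

Section Modules.
Variable R : pzRingType.

Definition projective (P : lmodType R) : Prop :=
  forall (M N : lmodType R) (g : {linear M -> N}) (f : {linear P -> N}),
    (forall y, exists x, g x = y) ->
    exists h : {linear P -> M}, forall x, g (h x) = f x.

Definition submod (V : lmodType R) (S : submodClosed V) : Type :=
  {x : V | x \in S}.

HB.instance Definition _ (V : lmodType R) (S : submodClosed V) :=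
  SubChoice.on (submod S).
HB.instance Definition _ (V : lmodType R) (S : submodClosed V) :=
  [SubChoice_isSubLmodule of submod S by <:].

(* Since a *: x = a * x in R^o, the submodules of R^o are the left ideals. *)
Definition left_hereditary : Prop :=
  forall I : submodClosed R^o, projective (submod I).

Definition factors_through_projective (A B : lmodType R) (h : A -> B) : Prop :=
  exists P : lmodType R, projective P /\
  exists (u : {linear A -> P}) (v : {linear P -> B}), forall x, h x = v (u x).

Definition stable_eq (A B : lmodType R) : rel {linear A -> B} :=
  fun f g => `[< factors_through_projective (f \- g) >].

Lemma factors_zero (A B : lmodType R) (h : A -> B) :
  (forall x, h x = 0) -> factors_through_projective h.
Proof.
move=> h0; exists 'rV[R]_0; split.
  by move=> M N g f _; exists \0 => x; rewrite (thinmx0 x) !raddf0.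
by exists \0, \0 => x; rewrite h0.
Qed.

Definition linear_of (U V : lmodType R) (f : U -> V) (fL : linear f) :
  {linear U -> V} := HB.pack f (GRing.isLinear.Build _ _ _ _ _ fL).

Lemma factors_opp (A B : lmodType R) (h k : A -> B) :
  (forall x, k x = - h x) ->
  factors_through_projective h -> factors_through_projective k.
Proof.
move=> kh [P [Pproj [u [v huv]]]]; exists P; split=> //.
by exists u, (v \o -%R) => x; rewrite kh huv /= raddfN.
Qed.

Lemma projective_pair (P Q : lmodType R) :
  projective P -> projective Q -> projective (P * Q)%type.
Proof.
move=> Pproj Qproj M N g f gsurj.
have inlL : linear (fun x : P => (x, 0) : P * Q).
  by move=> a x y; apply/pair_equal_spec; rewrite /= scaler0 addr0.
have inrL : linear (fun y : Q => (0, y) : P * Q).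
  by move=> a x y; apply/pair_equal_spec; rewrite /= scaler0 addr0.
have [h1 gh1] := Pproj M N g (f \o linear_of inlL) gsurj.
have [h2 gh2] := Qproj M N g (f \o linear_of inrL) gsurj.
have hL : linear (fun x : P * Q => h1 x.1 + h2 x.2).
  by move=> a x y; rewrite !linearP scalerDr addrACA.
exists (linear_of hL) => -[x y]; rewrite /linear_of /=.
rewrite linearD gh1 gh2 /= -linearD; congr (f _).
by congr (_, _); rewrite /= ?addr0 ?add0r.
Qed.

Lemma factors_add (A B : lmodType R) (h k l : A -> B) :
  (forall x, l x = h x + k x) -> factors_through_projective h ->
  factors_through_projective k -> factors_through_projective l.
Proof.
move=> lhk [P [Pproj [u [v huv]]]] [Q [Qproj [u' [v' kuv]]]].
exists (P * Q)%type; split; first exact: projective_pair.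
have uL : linear (fun x : A => (u x, u' x)).
  by move=> a x y; rewrite !linearP.
have vL : linear (fun x : P * Q => v x.1 + v' x.2).
  by move=> a x y; rewrite !linearP scalerDr addrACA.
exists (linear_of uL), (linear_of vL) => x /=.
by rewrite lhk huv kuv.
Qed.

Lemma stable_eq_refl (A B : lmodType R) : reflexive (@stable_eq A B).
Proof. by move=> f; apply/asboolP/factors_zero => x /=; rewrite subrr. Qed.

Lemma stable_eq_sym (A B : lmodType R) : symmetric (@stable_eq A B).
Proof.
by move=> f g; apply/asboolP/asboolP; apply: factors_opp => x /=;
  rewrite opprB.
Qed.

Lemma stable_eq_trans (A B : lmodType R) : transitive (@stable_eq A B).
Proof.
move=> g f h /asboolP fg /asboolP gh; apply/asboolP.
by apply: factors_add fg gh => x /=; rewrite addrA subrK.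
Qed.

Canonical stable_eq_equiv (A B : lmodType R) :=
  EquivRel (@stable_eq A B) (@stable_eq_refl A B) (@stable_eq_sym A B)
    (@stable_eq_trans A B).

Definition stable_hom (A B : lmodType R) : Type := {eq_quot @stable_eq A B}.

Definition stable_class (A B : lmodType R) (f : {linear A -> B}) :
  stable_hom A B := \pi_{eq_quot @stable_eq A B} f.

Lemma stable_classP (A B : lmodType R) (f g : {linear A -> B}) :
  stable_class f = stable_class g <-> factors_through_projective (f \- g).
Proof.
by split=> [/eqmodP /asboolP|/asboolP fg]; last exact/eqmodP.
Qed.

Lemma stable_class_surj (A B : lmodType R) (p : stable_hom A B) :
  exists f, p = stable_class f.
Proof. by exists (repr p); rewrite /stable_class reprK. Qed.

Definition stable_id (A : lmodType R) : stable_hom A A := stable_class idfun.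

Definition stable_comp (A B C : lmodType R)
    (q : stable_hom B C) (p : stable_hom A B) : stable_hom A C :=
  stable_class (repr q \o repr p).

Lemma stable_compE (A B C : lmodType R)
    (g : {linear B -> C}) (f : {linear A -> B}) :
  stable_comp (stable_class g) (stable_class f) = stable_class (g \o f).
Proof.
apply/stable_classP.
set g' := repr (stable_class g); set f' := repr (stable_class f).
have /stable_classP [P [Pproj [u [v guv]]]] : stable_class g' = stable_class g.
  by rewrite /stable_class reprK.
have /stable_classP [Q [Qproj [s [t fst_]]]] :
    stable_class f' = stable_class f.
  by rewrite /stable_class reprK.
apply: (@factors_add _ _ (fun x => v (u (f' x))) (fun x => g (t (s x)))).
- by move=> x; rewrite -guv -fst_ /= raddfB addrA subrK.
- by exists P; split=> //; exists (u \o f'), v.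
- by exists Q; split=> //; exists s, (g \o t).
Qed.

Lemma stable_class_ext (A B : lmodType R) (f g : {linear A -> B}) :
  f =1 g -> stable_class f = stable_class g.
Proof.
by move=> fg; apply/stable_classP/factors_zero => x /=; rewrite fg subrr.
Qed.

Lemma stable_comp_idl (A B : lmodType R) (p : stable_hom A B) :
  stable_comp (stable_id B) p = p.
Proof.
have [f ->] := stable_class_surj p.
by rewrite stable_compE; apply: stable_class_ext.
Qed.

Lemma stable_comp_idr (A B : lmodType R) (p : stable_hom A B) :
  stable_comp p (stable_id A) = p.
Proof.
have [f ->] := stable_class_surj p.
by rewrite stable_compE; apply: stable_class_ext.
Qed.

Lemma stable_compA (A B C D : lmodType R) (r : stable_hom C D)
    (q : stable_hom B C) (p : stable_hom A B) :
  stable_comp r (stable_comp q p) = stable_comp (stable_comp r q) p.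
Proof.
have [[h ->] [g ->] [f ->]] :=
  And3 (stable_class_surj r) (stable_class_surj q) (stable_class_surj p).
by rewrite !stable_compE; apply: stable_class_ext.
Qed.

Definition stable_category : category :=
  @Category (lmodType R) stable_hom stable_id stable_comp
    stable_comp_idl stable_comp_idr stable_compA.

End Modules.

(* Main.v *)
(* Let p : F -> B be a free cover. A stable kernel of f : A -> B is the pullback
   K of f and p with its projection i : K -> A: the composite K -> B factors
   through F, and a map X -> B factoring through a projective lifts along p.
   For uniqueness, let i d factor through a projective Q. The map Q -> A lifts
   to K, again because Q -> B lifts along p, so that d differs from a map
   factoring through Q by a map into ker i = ker p, which is projective as a
   submodule of a free module over a hereditary ring.
   Equalizers are kernels of differences, and together with finite products they
   give all finite limits. *)
From HB Require Import structures.
From mathcomp Require Import all_boot all_order all_algebra.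
From mathcomp Require Import boolp classical_sets functions fsbigop.
(* Defs comes last because vector.v also defines hom. *)
Require Import Defs.

Set Implicit Arguments.
Unset Strict Implicit.
Unset Printing Implicit Defensive.

Import GRing.Theory.
Local Open Scope ring_scope.

(** * Submodules of free modules over a hereditary ring *)

(** Submodules carry a boolean membership predicate; classical logic turns any [Prop]-valued set
    into one. *)
Definition set_pred (T : Type) (S : set T) : {pred T} := fun x => `[< S x >].

Lemma set_predP (T : Type) (S : set T) x : reflect (S x) (x \in set_pred S).
Proof. exact: asboolP. Qed.

Lemma set_pred_submod_closed (R : pzRingType) (V : lmodType R) (S : set V) :
  S 0 -> (forall a x y, S x -> S y -> S (a *: x + y)) ->
  submod_closed (set_pred S).
Proof.
move=> S0 SL; split=> [|a x y /set_predP Sx /set_predP Sy].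
  exact/set_predP.
exact/set_predP/SL.
Qed.

Definition set_submod (R : pzRingType) (V : lmodType R) (S : set V)
    (S0 : S 0) (SL : forall a x y, S x -> S y -> S (a *: x + y)) :
  submodClosed V :=
  HB.pack (set_pred S)
    (GRing.isSubmodClosed.Build R V (set_pred S)
      (GRing.submod_closed_semi (set_pred_submod_closed S0 SL))).

Lemma set_submodP (R : pzRingType) (V : lmodType R) (S : set V)
    (S0 : S 0) (SL : forall a x y, S x -> S y -> S (a *: x + y)) x :
  reflect (S x) (x \in set_submod S0 SL).
Proof. exact: set_predP. Qed.

(* The image of c is a left ideal, hence projective, so c splits onto it. *)
Lemma lift_extension (R : pzRingType) (V M N : lmodType R)
    (c : {linear V -> R^o}) (g : {linear M -> N}) (f : {linear V -> N})
    (h0 : V -> M) :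
  left_hereditary R -> (forall y, exists x, g x = y) ->
  (forall a x y, c x = 0 -> c y = 0 -> h0 (a *: x + y) = a *: h0 x + h0 y) ->
  (forall x, c x = 0 -> g (h0 x) = f x) ->
  exists h : {linear V -> M},
    (forall x, g (h x) = f x) /\ forall x, c x = 0 -> h x = h0 x.
Proof.
move=> hered g_surj h0L gh0.
have L0 : exists x, c x = 0 by exists 0; rewrite raddf0.
have LL a r t : (exists x, c x = r) -> (exists x, c x = t) ->
    exists x, c x = a *: r + t.
  by move=> [x <-] [y <-]; exists (a *: x + y); rewrite linearP.
pose L := @set_submod R R^o (fun r => exists x, c x = r) L0 LL.
have cL x : c x \in L by apply/set_submodP; exists x.
pose q x : submod L := Sub (c x) (cL x).
have qL : linear q.
  by move=> a x y; apply: val_inj; rewrite /= linearP.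
have [] := hered L V (submod L) (linear_of qL) idfun.
  move=> r; have /set_submodP [x cx] := valP r.
  by exists x; apply: val_inj.
move=> s qs; have [m gm] := hered L M N g (f \o s) g_surj.
have cs x : c (x - s (q x)) = 0.
  rewrite linearB /=; apply/eqP; rewrite subr_eq0; apply/eqP.
  exact: (esym (congr1 val (qs (q x)))).
(* The section [s] splits [V] into the kernel of [c] and the image of [s]: [h0] serves on the first
   summand, and the lift [m] of [f \o s] on the second. *)
have hL : linear (fun x => h0 (x - s (q x)) + m (q x)).
  move=> a x y; rewrite qL (linearP s) (linearP m) opprD addrACA -scalerN.
  by rewrite -scalerDr h0L // scalerDr addrACA.
exists (linear_of hL); split=> x.
  by rewrite linearD gh0 // gm /= -linearD subrK.
move=> cx0; rewrite /= (_ : q x = 0) ?raddf0 ?subr0 ?addr0 //.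
exact: val_inj.
Qed.

(* Zorn's lemma on the lifts defined on the elements supported in a subset J of
   I: lift_extension, applied to the coordinate i, enlarges J by i. *)
Lemma projective_of_coordinates (R : pzRingType) (I : eqType) (V : lmodType R)
    (c : I -> {linear V -> R^o}) :
  left_hereditary R ->
  (forall x, exists s : seq I, forall i, i \notin s -> c i x = 0) ->
  (forall x, (forall i, c i x = 0) -> x = 0) ->
  projective V.
Proof.
move=> hered c_fin c_inj M N g f g_surj.
pose supp (J : set I) x := forall i, c i x <> 0 -> J i.
have supp0 J : supp J 0 by move=> i; rewrite raddf0.
have suppD J a x y : supp J x -> supp J y -> supp J (a *: x + y).
  move=> Jx Jy i; rewrite linearP; have [->|/eqP /Jx //] := eqVneq (c i x) 0.
  have [->|/eqP /Jy //] := eqVneq (c i y) 0.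
  by rewrite scaler0 addr0.
(* A partial lift is a total function constrained only on the elements supported in [t.1]; its other
   values are junk, so [le] is only a preorder. *)
pose partial (t : set I * (V -> M)) :=
  (forall a x y, supp t.1 x -> supp t.1 y ->
     t.2 (a *: x + y) = a *: t.2 x + t.2 y) /\
  (forall x, supp t.1 x -> g (t.2 x) = f x).
pose le (s t : {t | partial t}) := `[< subset (sval s).1 (sval t).1 /\
  forall x, supp (sval s).1 x -> (sval t).2 x = (sval s).2 x >].
have base : partial (set0, fun=> 0).
  split=> [a x y _ _|x x0] /=; first by rewrite scaler0 addr0.
  rewrite (c_inj x) ?raddf0 // => i; apply/eqP/negP => /negP /eqP.
  exact: x0.
have [|r s t|A totA|t t_max] := @ZL_preorder _ (exist _ _ base) le.
- by move=> t; apply/asboolP; split.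
- move=> /asboolP [rs hrs] /asboolP [st hst]; apply/asboolP; split.
    by move=> i /rs /st.
  by move=> x rx; rewrite hst ?hrs // => i /rx /rs.
- have [[t0 At0]|A0] := pselect (exists t, A t); last first.
    by exists (exist _ _ base) => s As; case: A0; exists s.
  pose J : set I := fun i => exists2 t, A t & (sval t).1 i.
  (* The support of [x] is finite, so one member of the chain contains all of it: induction along a
     list, keeping the larger of two members. *)
  have cover x : supp J x -> exists2 t, A t & supp (sval t).1 x.
    move=> Jx; have [s sx] := c_fin x.
    suff [t At ts] : exists2 t, A t &
        forall i, i \in s -> c i x <> 0 -> (sval t).1 i.
      exists t => // i cix; apply: ts => //.
      by apply/negPn/negP => /sx.
    elim: s {sx} => [|i s [t At IH]]; first by exists t0.
    have [cix|/eqP /Jx [u Au ui]] := eqVneq (c i x) 0.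
      exists t => // j; rewrite inE => /orP [/eqP -> //|]; exact: IH.
    have [/asboolP [tu _]|/asboolP [ut _]] := totA t u At Au.
      exists u => // j; rewrite inE => /orP [/eqP -> //|js cj].
      exact/tu/IH.
    exists t => // j; rewrite inE => /orP [/eqP -> _|]; last exact: IH.
    exact: ut.
  (* The glued lift takes at [x] the common value of all members of the chain whose set supports
     [x], with default 0 if there are none. *)
  have /choice [h hP] : forall x, exists m, forall t, A t ->
      supp (sval t).1 x -> m = (sval t).2 x.
    move=> x; have [[t At tx]|no] := pselect (exists2 t, A t &
      supp (sval t).1 x); last first.
      by exists 0 => t At tx; case: no; exists t.
    exists ((sval t).2 x) => u Au ux.
    by have [] := totA t u At Au => /asboolP [_ ->].
  have common x y : supp J x -> supp J y ->
      exists t, [/\ A t, supp (sval t).1 x & supp (sval t).1 y].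
    move=> /cover [t At tx] /cover [u Au uy].
    have [/asboolP [tu _]|/asboolP [ut _]] := totA t u At Au.
      by exists u; split=> // i /tx /tu.
    by exists t; split=> // i /uy /ut.
  have partialJ : partial (J, h).
    split=> /= [a x y Jx Jy|x /cover [t At tx]]; last first.
      by rewrite (hP x t) //; case: (svalP t) => _; apply.
    have [t [At tx ty]] := common x y Jx Jy.
    rewrite !(hP _ t) //; last exact: suppD.
    by case: (svalP t) => + _; apply.
  exists (exist _ _ partialJ) => t At; apply/asboolP; split=> [i ti|x tx] /=.
    by exists t.
  exact: hP.
- case: t t_max => -[J h] Jh t_max; have [/= hL gh] := Jh.
  have full i : J i.
    apply: contrapT => nJi.
    pose J' : set I := fun j => J j \/ j = i.
    pose W := set_submod (supp0 J') (suppD J').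
    (* On [W] the kernel of the new coordinate consists of the elements supported in [J], where [h]
       is already a linear lift. *)
    pose c' : {linear submod W -> R^o} := c i \o val.
    have suppW (x : submod W) : c' x = 0 <-> supp J (val x).
      split=> [c'x j cj|Jx].
        have /set_submodP /(_ j cj) [//|ji] := valP x.
        by case: cj; rewrite ji.
      apply/eqP/negPn/negP => /eqP /Jx; exact: nJi.
    have [|x|h' [gh' h'h]] := @lift_extension R (submod W) M N c' g
      (f \o val) (h \o val) hered g_surj.
    + by move=> a x y /suppW Jx /suppW Jy /=; rewrite hL.
    + by move=> /suppW; apply: gh.
    have valW x : supp J' x -> val (insubd (0 : submod W) x) = x.
      by move=> J'x; apply: insubdK; apply/(set_submodP (supp0 J') (suppD J')).
    (* [insubd 0] sends the elements outside [W] to 0, which extends [h'] to a total function on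
       [V]. *)
    have partial' : partial (J', fun x => h' (insubd 0 x)).
      split=> /= [a x y J'x J'y|x J'x]; last by rewrite gh' /= valW.
      rewrite -linearP; congr (h' _); apply: val_inj.
      rewrite (linearP (val : {linear submod W -> V}) a).
      rewrite valW; last exact (@suppD J' a x y J'x J'y).
      by congr (_ *: _ + _); apply/esym/valW.
    have /t_max/asboolP [JJ' _] :
        le (exist _ _ Jh) (exist _ _ partial').
      apply/asboolP; split=> [j|x Jx] /=; first by left.
      have xE : val (insubd (0 : submod W) x) = x.
        by apply: valW => j /Jx; left.
      have cx0 : c' (insubd 0 x) = 0 by apply/suppW; rewrite xE.
      by rewrite h'h //= xE.
    by apply: nJi; apply: JJ'; right.
  have hL' : linear h by move=> a x y; apply: hL => j _; apply: full.
  by exists (linear_of hL') => x; apply: gh => j _; apply: full.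
Qed.

(** [F] is the free module on the underlying set of [B], realised as finitely supported functions.
    Its coordinates, pulled back along [i], meet the conditions of [projective_of_coordinates].
    Stating this for injections covers both [F] itself and the kernel of [p]. *)
Lemma hereditary_free_cover (R : pzRingType) (B : lmodType R) :
  left_hereditary R ->
  exists (F : lmodType R) (p : {linear F -> B}),
    (forall y, exists x, p x = y) /\
    forall (K : lmodType R) (i : {linear K -> F}), injective i -> projective K.
Proof.
move=> hered.
pose finsupp (x : B -> R^o) := exists s : seq B,
  forall b, b \notin s -> x b = 0 :> R.
have fin0 : finsupp 0 by exists [::].
have finD a x y : finsupp x -> finsupp y -> finsupp (a *: x + y).
  move=> [s sx] [t ty]; exists (s ++ t) => b.
  rewrite mem_cat negb_or => /andP [bs bt].
  by transitivity (a * x b + y b); rewrite // sx // ty // mulr0 addr0.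
pose F := submod (set_submod fin0 finD).
pose p (x : F) : B := \sum_(b \in [set: B]%classic) (val x b : R) *: b.
(* Any duplicate-free list containing the support computes [p x], so two arguments can share one
   list. *)
have pE s (x : F) : uniq s -> (forall b, b \notin s -> val x b = 0) ->
    p x = \sum_(b <- s) (val x b : R) *: b.
  move=> s_uniq sx; rewrite /p (fsbigE s) // => [|b _ /sx ->].
    by apply: eq_bigl => b; rewrite in_setT.
  by rewrite scale0r.
have pL : linear p.
  move=> a x y.
  have /set_submodP [s sx] := valP x; have /set_submodP [t ty] := valP y.
  have out b : b \notin undup (s ++ t) -> val x b = 0 /\ val y b = 0.
    by rewrite mem_undup mem_cat negb_or => /andP [/sx ? /ty ?].
  rewrite !(pE (undup (s ++ t))) ?undup_uniq //; try by move=> b /out [].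
    rewrite scaler_sumr -big_split /=; apply: eq_bigr => b _.
    by rewrite scalerA -scalerDl.
  move=> b /out [xb yb].
  by transitivity (a * val x b + val y b); rewrite // xb yb mulr0 addr0.
exists F, (linear_of pL); split=> [y|K i i_inj].
  (* The basis vector at [y]. *)
  pose d : B -> R^o := fun b => if b == y then 1 else 0.
  have dy b : b \notin [:: y] -> d b = 0.
    by rewrite inE /d => /negbTE ->.
  have dP : d \in set_submod fin0 finD by apply/set_submodP; exists [:: y].
  exists (Sub d dP); rewrite /= (pE [:: y]) //.
  by rewrite big_seq1 /= /d eqxx scale1r.
pose c b (x : K) : R^o := val (i x) b.
have cL b : linear (c b) by move=> a x y; rewrite /c linearP.
apply: (@projective_of_coordinates R B K (fun b => linear_of (cL b))) => // x.
  by have /set_submodP [s sx] := valP (i x); exists s.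
move=> x0; apply: i_inj; rewrite raddf0; apply: val_inj; apply/funext => b.
exact: x0.
Qed.

(** * Finite limits from products and equalizers *)

Definition is_product (C : category) (T : Type) (A : T -> C) (p : C)
    (pr : forall t, hom p (A t)) : Prop :=
  forall (x : C) (f : forall t, hom x (A t)),
    exists! u : hom x p, forall t, comp (pr t) u = f t.

Definition has_products_over (C : category) (T : Type) : Prop :=
  forall A : T -> C, exists p (pr : forall t, hom p (A t)), is_product pr.

Definition has_binary_products (C : category) : Prop :=
  forall a b : C, exists (p : C) (p1 : hom p a) (p2 : hom p b),
  forall (x : C) (f : hom x a) (g : hom x b),
    exists! u : hom x p, comp p1 u = f /\ comp p2 u = g.

Definition has_terminal (C : category) : Prop :=
  exists z : C, forall a : C, exists! f : hom a z, True.

Definition is_equalizer (C : category) (a b : C) (f g : hom a b)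
    (e : C) (i : hom e a) : Prop :=
  comp f i = comp g i /\
  forall (x : C) (w : hom x a), comp f w = comp g w ->
    exists! u : hom x e, comp i u = w.

Definition has_equalizers (C : category) : Prop :=
  forall (a b : C) (f g : hom a b), exists e (i : hom e a), is_equalizer f g i.

Section FiniteLimits.
Variable C : category.

Lemma has_products_over_bij (S T : Type) (e : S -> T) :
  bijective e -> has_products_over C S -> has_products_over C T.
Proof.
move=> e_bij prodS A; have [e' eK e'K] := e_bij.
have [p [pr prP]] := prodS (A \o e).
(* Describing the projection to [A t] by all [s] with [e s = t] confines the cast to this step: at
   [t = e s] the proof [erefl] gives back [pr s]. *)
have /(_ _)/cid prT t : exists q : hom p (A t),
    forall s (st : e s = t), q = ecast t (hom p (A t)) st (pr s).
  rewrite -(e'K t); exists (pr (e' t)) => s st.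
  have st' : s = e' t by apply: (can_inj eK).
  by case: _ / st' in st *; rewrite (Prop_irrelevance st erefl).
exists p, (fun t => sval (prT t)) => x f.
have prE s : sval (prT (e s)) = pr s by exact: (svalP (prT (e s)) s erefl).
have [u [uP u_uniq]] := prP x (fun s => f (e s)).
exists u; split=> [t|v vP]; first by rewrite -(e'K t) prE uP.
by apply: u_uniq => s; rewrite -prE vP.
Qed.

Lemma has_products_over_option (T : Type) :
  has_binary_products C -> has_products_over C T ->
  has_products_over C (option T).
Proof.
move=> bin prodT A; have [q [pr prP]] := prodT (A \o Some).
have [p [p1 [p2 pP]]] := bin (A None) q.
exists p, (fun o => if o is Some t then comp (pr t) p2 else p1) => x f.
have [v [vP v_uniq]] := prP x (fun t => f (Some t)).
have [u [[u1 u2] u_uniq]] := pP x (f None) v.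
exists u; split=> [[t|]//|w wP]; first by rewrite -compA u2 vP.
apply: u_uniq; split; first exact: wP None.
by apply/esym/v_uniq => t; rewrite compA; apply: (wP (Some t)).
Qed.

(** Induction on the cardinality: [lift ord0] and [unlift ord0] identify ['I_n.+1] with
    [option 'I_n], and each added point costs one binary product. *)
Lemma has_finite_products (T : Type) :
  has_terminal C -> has_binary_products C -> finite_type T ->
  has_products_over C T.
Proof.
move=> [z zP] bin [n [e e_bij]]; apply: has_products_over_bij e_bij _.
elim: n {T e} => [|n IH].
  move=> A; exists z, (fun i : 'I_0 => match notF (ltn_ord i) with end) => x f.
  have [u [_ u_uniq]] := zP x; exists u.
  by split=> [[]//|v _]; apply: u_uniq.
pose e (o : option 'I_n) := if o is Some i then lift ord0 i else ord0.
apply: (@has_products_over_bij _ _ e) (has_products_over_option bin IH).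
exists (unlift ord0) => [[i|]|i] /=; rewrite ?liftK ?unlift_none //.
by case: unliftP.
Qed.

(** A condition on arrows into [a] expressed by one parallel pair; an equalizer of that pair is then
    universal among the arrows satisfying it. *)
Definition is_equation (a : C) (Phi : forall x, hom x a -> Prop) : Prop :=
  exists b (u v : hom a b), forall x (w : hom x a),
    Phi x w <-> comp u w = comp v w.

(* Working with equations avoids a product over the type of all arrows of a
   diagram, which is a dependent sum. *)
Lemma is_equation_forall (T : Type) (a : C)
    (Phi : T -> forall x, hom x a -> Prop) :
  has_products_over C T -> (forall t, is_equation (Phi t)) ->
  is_equation (fun x w => forall t, Phi t x w).
Proof.
move=> prodT eqPhi.
have /(_ _)/cid E t : exists E : {b : C & hom a b * hom a b}%type,
    forall x (w : hom x a),
      Phi t x w <-> comp (projT2 E).1 w = comp (projT2 E).2 w.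
  by have [b [u [v uvP]]] := eqPhi t; exists (existT _ b (u, v)).
(* The pairs for the various [t] are tupled into one pair with values in the product of their
   codomains. *)
have [b [pr prP]] := prodT (fun t => projT1 (sval (E t))).
have [u [uP _]] := prP a (fun t => (projT2 (sval (E t))).1).
have [v [vP _]] := prP a (fun t => (projT2 (sval (E t))).2).
exists b, u, v => x w; split=> [Phiw|uv t].
  have [m [_ m_uniq]] := prP x (fun t => comp (projT2 (sval (E t))).1 w).
  rewrite -(m_uniq (comp u w)) => [|t]; last by rewrite compA uP.
  by apply: m_uniq => t; rewrite compA vP; apply/esym/(svalP (E t)).
by apply/(svalP (E t)); rewrite -uP -vP -!compA uv.
Qed.

(** The limit is the equalizer, over the product of all [F j], of a single pair expressing that the
    projections form a cone. *)
Lemma finitely_complete_products_equalizers :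
  has_terminal C -> has_binary_products C -> has_equalizers C ->
  finitely_complete C.
Proof.
move=> term bin eqz J [Jfin homfin] F.
have prods T := @has_finite_products T term bin.
have [p [pr prP]] := prods J Jfin F.
have [b [u [v uvP]]] : is_equation (fun x (w : hom x p) =>
    forall i j (f : hom i j), comp (fmap F f) (comp (pr i) w) = comp (pr j) w).
  apply: is_equation_forall => [|i]; first exact: prods.
  apply: is_equation_forall => [|j]; first exact: prods.
  apply: is_equation_forall => [|f]; first exact/prods/homfin.
  by exists (F j), (comp (fmap F f) (pr i)), (pr j) => x w; rewrite -compA.
have [e [i [ui iP]]] := eqz p b u v.
have legP := (uvP _ _).2 ui.
exists (@Cone J C F e (fun j => comp (pr j) i) legP) => K.
have [m [mP m_uniq]] := prP (apex K) (@leg _ _ _ K).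
have [|w [wP w_uniq]] := iP _ m.
  by apply/uvP => i1 j f; rewrite !mP leg_natural.
exists w; split=> [j|w' w'P] /=; first by rewrite -compA wP mP.
by apply: w_uniq; apply/esym/m_uniq => j; rewrite compA w'P.
Qed.

End FiniteLimits.

(** * The stable category *)

Section StableCategory.
Variable R : pzRingType.
Implicit Types A B X : lmodType R.
Local Notation Mod := (stable_category R).

Lemma factors_postcomp A B X (f : {linear B -> X}) (g : A -> B) :
  factors_through_projective g ->
  factors_through_projective (fun x => f (g x)).
Proof.
move=> [P [Pproj [u [v guv]]]]; exists P; split=> //.
by exists u, (f \o v) => x; rewrite /= guv.
Qed.

Lemma stable_class0P A B (f : {linear A -> B}) :
  stable_class f = stable_class (\0 : {linear A -> B}) <->
  factors_through_projective f.
Proof.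
rewrite stable_classP (_ : f \- _ = f) //.
by apply/funext => x; rewrite /= subr0.
Qed.

Lemma stable_zero_object : @zero_object Mod 'rV[R]_0.
Proof.
move=> A; split; exists (stable_class \0); split=> // p _;
  have [f ->] := stable_class_surj p; apply: stable_class_ext => x /=.
  by rewrite [RHS]thinmx0.
by rewrite (thinmx0 x) raddf0.
Qed.

Lemma stable_zero_morphismP A B (f : {linear A -> B}) :
  zero_morphism (stable_class f : @hom Mod A B) <->
  factors_through_projective f.
Proof.
rewrite -stable_class0P; split=> [[Z [Z0 [p [q ->]]]]|->].
  have [g ->] := stable_class_surj p; have [h ->] := stable_class_surj q.
  (* [Z] is an arbitrary zero object, not necessarily the zero module; uniqueness of arrows into it
     identifies [h] with 0 stably. *)
  have [[k [_ k_uniq]] _] := Z0 A.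
  rewrite -(k_uniq (stable_class h) I) (k_uniq (stable_class \0) I) /=.
  by rewrite stable_compE; apply: stable_class_ext => x /=; rewrite raddf0.
exists ('rV[R]_0 : lmodType R); split; first exact: stable_zero_object.
exists (stable_class \0), (stable_class \0); rewrite /= stable_compE.
exact: stable_class_ext.
Qed.

Lemma stable_has_kernels :
  left_hereditary R -> has_kernels Mod.
Proof.
move=> hered A B fc; have [f {fc}->] := stable_class_surj fc.
have [F [p [p_surj Fsub]]] := hereditary_free_cover B hered.
have F_proj : projective F by apply: (Fsub F idfun).
have K0 : f (0 : A * F).1 = p (0 : A * F).2 by rewrite !raddf0.
have KL a (x y : A * F) : f x.1 = p x.2 -> f y.1 = p y.2 ->
    f (a *: x + y).1 = p (a *: x + y).2.
  by move=> fx fy; rewrite !linearP fx fy.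
pose K := submod (@set_submod R (A * F)%type (fun x => f x.1 = p x.2) K0 KL).
have KE (x : K) : f (val x).1 = p (val x).2.
  exact: (set_submodP K0 KL _ (valP x)).
(* The universal property of the pullback, for honest linear maps. *)
have toK (X : lmodType R) (u : {linear X -> A}) (v : {linear X -> F}) :
    (forall x, f (u x) = p (v x)) ->
    exists w : {linear X -> K}, forall x, val (w x) = (u x, v x).
  move=> uv; have wP x : (u x, v x) \in set_submod K0 KL.
    exact/(set_submodP K0 KL)/uv.
  have wL : linear (fun x => Sub (u x, v x) (wP x) : K).
    by move=> a x y; apply: val_inj; rewrite /= !linearP.
  by exists (linear_of wL).
pose i : {linear K -> A} := fst \o val.
pose j : {linear K -> F} := snd \o val.
exists (K : lmodType R), (stable_class i); split.
  rewrite [comp _ _]stable_compE; apply/stable_zero_morphismP.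
  by exists F; split=> //; exists j, p; apply: KE.
move=> X gc; have [g {gc}->] := stable_class_surj gc.
rewrite [comp _ _]stable_compE.
move=> /stable_zero_morphismP [P [Pproj [u [v guv]]]].
have [v' v'P] := Pproj F B p v p_surj.
have [|w wP] := toK X g (v' \o u); first by move=> x; rewrite /= v'P -guv.
exists (stable_class w); split.
  rewrite [comp _ _]stable_compE; apply: stable_class_ext => x.
  by rewrite /= wP.
move=> tc; have [t {tc}->] := stable_class_surj tc.
rewrite [comp _ _]stable_compE => /esym/stable_classP [Q [Qproj [a [b gab]]]].
have [c cP] := Qproj F B p (f \o b) p_surj.
have [|d dP] := toK Q b c; first by move=> x; rewrite cP.
have N0 : p 0 = 0 := raddf0 p.
have NL r x y : p x = 0 -> p y = 0 -> p (r *: x + y) = 0.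
  by move=> px py; rewrite linearP px py scaler0 addr0.
pose N := submod (set_submod N0 NL).
have N_proj : projective N by apply: (Fsub N val); apply: val_inj.
(* Since [i (w - t) = b a = i d a], the map [e] has first component 0, and hence its second
   component lies in [N], the kernel of [p]. *)
pose e : {linear X -> K} := (w \- t) \- (d \o a).
have e1 x : (val (e x)).1 = 0.
  rewrite -[LHS]/(i (w x - t x - d (a x))) !raddfB /= wP dP /= -gab /=.
  by rewrite addrN.
have e2 x : p (val (e x)).2 = 0 by rewrite -KE e1 raddf0.
have eN x : (val (e x)).2 \in set_submod N0 NL by apply/(set_submodP N0 NL).
have [|n nP] := toK N \0 val.
  by move=> x; rewrite raddf0 (set_submodP N0 NL _ (valP x)).
have mL : linear (fun x => Sub (val (e x)).2 (eN x) : N).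
  by move=> r x y; apply: val_inj; exact: (linearP (j \o e)).
apply/stable_classP.
(* With [n y = (0, y)], this is [w - t = d a + n m], where the summands pass through the projectives
   [Q] and [N]. *)
apply: (@factors_add _ _ _ (d \o a) (n \o linear_of mL)).
- move=> x; rewrite addrC; apply: (canRL (subrK _)); apply: val_inj.
  transitivity (val (e x)); first by [].
  by rewrite /= nP -[RHS]/((0, (val (e x)).2)) -(e1 x) -surjective_pairing.
- by exists Q; split=> //; exists a, d.
- by exists N; split=> //; exists (linear_of mL), n.
Qed.

Lemma stable_has_terminal : has_terminal Mod.
Proof.
by exists ('rV[R]_0 : lmodType R) => A; have [] := stable_zero_object A.
Qed.

(** The module product works: if both components of a map factor through projectives, so does the
    map, as the sum of the components followed by the two inclusions. *)
Lemma stable_has_binary_products : has_binary_products Mod.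
Proof.
move=> A B.
exists (A * B : lmodType R)%type, (stable_class fst), (stable_class snd)
  => X fc gc.
have [f {fc}->] := stable_class_surj fc.
have [g {gc}->] := stable_class_surj gc.
have uL : linear (fun x => (f x, g x)) by move=> a x y; rewrite !linearP.
have inlL : linear (fun x : A => (x, 0) : A * B).
  by move=> a x y; apply/pair_equal_spec; rewrite /= scaler0 addr0.
have inrL : linear (fun y : B => (0, y) : A * B).
  by move=> a x y; apply/pair_equal_spec; rewrite /= scaler0 addr0.
exists (stable_class (linear_of uL)); split.
  by split; rewrite [comp _ _]stable_compE; apply: stable_class_ext.
move=> vc; have [v {vc}->] := stable_class_surj vc.
rewrite ![comp _ _]stable_compE.
move=> [/esym/stable_classP fv /esym/stable_classP gv].
apply/stable_classP.
apply: factors_add (factors_postcomp (linear_of inlL) fv)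
  (factors_postcomp (linear_of inrL) gv) => x.
apply: (etrans (surjective_pairing _)); apply/pair_equal_spec.
by rewrite /= addr0 add0r.
Qed.

Lemma stable_has_equalizers :
  left_hereditary R -> has_equalizers Mod.
Proof.
move=> hered A B fc gc.
have [f {fc}->] := stable_class_surj fc.
have [g {gc}->] := stable_class_surj gc.
have diffP X (w : @hom Mod X A) :
    comp (stable_class f : @hom Mod A B) w =
      comp (stable_class g : @hom Mod A B) w <->
    zero_morphism (comp (stable_class (f \- g) : @hom Mod A B) w).
  have [u ->] := stable_class_surj w.
  rewrite ![comp _ _]stable_compE stable_zero_morphismP.
  exact: stable_classP.
have [K [i [i0 iP]]] :=
  stable_has_kernels hered (stable_class (f \- g) : @hom Mod A B).
exists K, i; split; first exact/diffP.
by move=> X w /diffP; apply: iP.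
Qed.

End StableCategory.

Theorem proposition4p11 (Lambda : pzRingType) :
  left_hereditary Lambda ->
  has_kernels (stable_category Lambda) /\
  finitely_complete (stable_category Lambda).
Proof.
move=> hered; split; first exact: stable_has_kernels.
apply: finitely_complete_products_equalizers.
- exact: stable_has_terminal.
- exact: stable_has_binary_products.
- exact: stable_has_equalizers.
Qed.
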